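(* Let $x^0\in\Omega$ and $y^0=(x^0)^r$. For every $L\in\mathcal L$ and every function $\eta$ holomorphic on an open set containing $\sigma(y^0)$ for every $\sigma$ in the subgroup of $S_n$ generated by the transpositions $s_{ij}$ occurring in the construction of $L$ (in particular containing $y^0$), and such that $L\eta$ (formed step by step according to the construction of $L$) is defined near $y^0$, one has, for $\phi(x):=\eta(x^r)$, $$\widetilde L\,\phi=(L\eta)(x^r)$$ near $x^0$.
   Context: Let $n,r\ge1$ be integers, $\Omega=\{x\in\mathbb{C}^n: x_i\ne0\text{ for all }i\}$, and for $x\in\mathbb{C}^n$ write $x^r=(x_1^r,\dots,x_n^r)$. On $\Omega$ let $\Delta_i=\frac{1}{r\,x_i^{r-1}}\partial_{x_i}$. $S_n$ acts on $\mathbb{C}^n$ by permuting coordinates. $\mathcal L$ is the class of operators on holomorphic functions of $y=(y_1,\dots,y_n)$, each given together with its construction (a formal expression), built inductively as follows: (i) $\partial_{y_i}$ ($1\le i\le n$) and multiplication by a rational function $q(y)\in\mathbb{C}(y_1,\dots,y_n)$ are in $\mathcal L$; (ii) the transposition $s_{ij}$ ($1\le i<j\le n$), acting by $\eta\mapsto\eta\circ s_{ij}$ (exchange of the variables $y_i,y_j$), is in $\mathcal L$; (iii) if $L_1,L_2\in\mathcal L$ then $L_1+L_2\in\mathcal L$; (iv) if $L_1,L_2\in\mathcal L$ then $L_1\circ L_2\in\mathcal L$, acting by $\eta\mapsto L_1(L_2\eta)$. The transfer $\widetilde L$ of $L\in\mathcal L$ is the operator in the variables $x$ obtained by replacing everywhere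 $\partial_{y_i}$ by $\Delta_i$, multiplication by $q(y)$ by multiplication by $q(x^r)$, and $s_{ij}$ by $\sigma_{ij}$, where $\sigma_{ij}\phi=\phi\circ\sigma_{ij}$ is the exchange of $x_i,x_j$; sums and compositions are preserved. *)

(* Defs.v *)
From HB Require Import structures.
From mathcomp Require Import all_boot all_order all_algebra all_fingroup.
From mathcomp Require Import complex.
(* The notations of mpoly clash with those of MathComp-Analysis. *)
From mathcomp Require Import (canonicals) mpoly.
From mathcomp Require Import boolp classical_sets reals.
From mathcomp Require Import topology normedtype derive.

Set Implicit Arguments.
Unset Strict Implicit.
Unset Printing Implicit Defensive.

Import Order.TTheory GRing.Theory Num.Theory.
Import numFieldNormedType.Exports.

Local Open Scope ring_scope.
Local Open Scope classical_set_scope.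
Local Open Scope complex_scope.

(* Typing R[i] as a numClosedFieldType gives it, and hence 'rV[CC R]_n, the
   modulus norm and its topology; derivatives over CC R are complex ones. *)
Definition CC (R : realType) : numClosedFieldType := R[i].

Definition ratfun (R : realType) (n : nat) := {fraction mpoly.mpoly n (CC R)}.

Section RationalFunctions.
Context {R : realType} {n : nat}.
Implicit Types (q : ratfun R n) (y : 'rV[CC R]_n).
Implicit Types a b : mpoly.mpoly n (CC R).

Definition peval a y : CC R := mpoly.meval (fun i => y 0 i) a.

(* q is regular at y when some fraction representing q has a denominator that
   does not vanish at y; its value there does not depend on the fraction, see
   [rat_evalE]. *)
Definition regular_at q y :=
  exists a b, q = tofrac a / tofrac b /\ peval b y != 0.

Definition rat_eval q y : CC R :=
  xget 0 [set c | exists a b,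
    [/\ q = tofrac a / tofrac b, peval b y != 0 & c = peval a y / peval b y]].

Lemma rat_evalE a b y : peval b y != 0 ->
  rat_eval (tofrac a / tofrac b) y = peval a y / peval b y.
Proof.
move=> by0; rewrite /rat_eval; case: xgetP => [c -> [a' [b' [eq_ab b'y0 ->]]]|].
  have nz d : peval d y != 0 -> tofrac d != 0.
    apply: contra_neq => /eqP; rewrite tofrac_eq0 => /eqP ->.
    exact: mpoly.meval0.
  apply/eqP; rewrite eqr_div //; apply/eqP.
  move/eqP: eq_ab; rewrite eqr_div ?nz // -!tofracM tofrac_eq => /eqP eq_ab.
  by rewrite /peval -!mpoly.mevalM eq_ab.
by move=> /(_ (peval a y / peval b y)) []; exists a, b.
Qed.

End RationalFunctions.

(* A function [pfun_val] considered on [pfun_dom] only. *)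
Record pfun (R : realType) (n : nat) := PFun {
  pfun_dom : set 'rV[CC R]_n ;
  pfun_val : 'rV[CC R]_n -> CC R }.

Definition holomorphic_on (R : realType) (n : nat)
    (U : set 'rV[CC R]_n) (f : 'rV[CC R]_n -> CC R) :=
  open U /\ forall y, U y -> differentiable f y.

Section Operators.
Context {R : realType} {n : nat}.
Implicit Types (f : pfun R n) (q : ratfun R n) (i j : 'I_n).

Definition Omega : set 'rV[CC R]_n := [set x | forall i, x 0 i != 0].

Definition powv (r : nat) (x : 'rV[CC R]_n) : 'rV[CC R]_n :=
  \row_i (x 0 i) ^+ r.

(* A holomorphic function is infinitely differentiable on its open domain, so a
   derivation does not shrink the domain: only poles do (and, for [Delta], the
   complement of [Omega]). *)
Definition partial i f : pfun R n :=
  PFun (pfun_dom f) (fun y => 'D_(delta_mx 0 i) (pfun_val f) y).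

Definition Delta (r : nat) i f : pfun R n :=
  PFun (pfun_dom f `&` Omega)
    (fun x => (r%:R * x 0 i ^+ r.-1)^-1 * 'D_(delta_mx 0 i) (pfun_val f) x).

Definition mulq q f : pfun R n :=
  PFun (pfun_dom f `&` regular_at q) (fun y => rat_eval q y * pfun_val f y).

Definition mulq_pow (r : nat) q f : pfun R n :=
  PFun (pfun_dom f `&` [set x | regular_at q (powv r x)])
    (fun x => rat_eval q (powv r x) * pfun_val f x).

Definition swapv i j : 'rV[CC R]_n -> 'rV[CC R]_n := col_perm (tperm i j).

Definition swap i j f : pfun R n :=
  PFun (swapv i j @^-1` pfun_dom f) (pfun_val f \o swapv i j).

Definition addp f1 f2 : pfun R n :=
  PFun (pfun_dom f1 `&` pfun_dom f2) (fun y => pfun_val f1 y + pfun_val f2 y).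

End Operators.

Inductive lexpr (R : realType) (n : nat) : Type :=
| Partial of 'I_n
| Mul of ratfun R n
| Swap (i j : 'I_n) of (i < j)%N
| Add of lexpr R n & lexpr R n
| Comp of lexpr R n & lexpr R n.

Fixpoint interp (R : realType) (n : nat)
    (der : 'I_n -> pfun R n -> pfun R n)
    (mul : ratfun R n -> pfun R n -> pfun R n)
    (swp : 'I_n -> 'I_n -> pfun R n -> pfun R n)
    (L : lexpr R n) (f : pfun R n) : pfun R n :=
  match L with
  | Partial i => der i f
  | Mul q => mul q f
  | Swap i j _ => swp i j f
  | Add L1 L2 => addp (interp der mul swp L1 f) (interp der mul swp L2 f)
  | Comp L1 L2 => interp der mul swp L1 (interp der mul swp L2 f)
  end.

Definition lact (R : realType) (n : nat) : lexpr R n -> pfun R n -> pfun R n :=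
  interp partial mulq swap.

Definition transfer (R : realType) (n r : nat) :
    lexpr R n -> pfun R n -> pfun R n :=
  interp (Delta r) (mulq_pow r) swap.

(* Orbits of points under <<swaps L>> are taken for [col_perm]; whether s acts by
   y_i |-> y_(s i) or y_(s^-1 i) does not change the orbit of a subgroup. *)
Fixpoint swaps (R : realType) (n : nat) (L : lexpr R n) : {set 'S_n} :=
  match L with
  | Partial _ | Mul _ => finset.set0
  | Swap i j _ => [set tperm i j]%SET
  | Add L1 L2 | Comp L1 L2 => swaps L1 :|: swaps L2
  end.

(* Main.v *)
(* The substitution y = x^r intertwines d/dy_i with Delta_i by the chain rule,
   and it commutes with coordinate exchanges and with multiplications, so the
   identity propagates along the construction of L at every point of Omega.
   The chain rule is applied to intermediate functions whose differentiability
   is not established (this would require that partial derivatives of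
   holomorphic functions are holomorphic): h |-> (a + h)^r - a^r is continuous
   and open at 0 when a <> 0, so the two difference quotients converge
   simultaneously, and when they diverge both derivatives are the junk value 0. *)
Require Import Defs.
From mathcomp Require Import all_boot all_order all_algebra all_fingroup.
From mathcomp Require Import boolp classical_sets functions reals.
From mathcomp Require Import topology normedtype derive.

Import Order.TTheory GRing.Theory Num.Theory.
Import numFieldNormedType.Exports.
Local Open Scope ring_scope.
Local Open Scope classical_set_scope.

(** Convergence of [u] is not assumed: as [v] is eventually nonzero, dividing by it shows that [u]
    and [u \* v] converge or diverge together. *)
Lemma lim_mul_cvg_neq0 (K : numFieldType) (T : Type) (F : set_system T)
    (FF : ProperFilter F) (u v : T -> K) (c : K) :
  c != 0 -> v @ F --> c -> lim ((u \* v) @ F) = lim (u @ F) * c.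
Proof.
move=> c0 vc; have [uF|uF] := pselect (cvg (u @ F)).
  by apply: cvg_lim => //; exact: cvgM.
(* [lim] is [point = 0] on a divergent filter. *)
rewrite (dvgP uF) mul0r dvgP// => uvF; apply: uF.
have uE : {near F, (u \* v) \* (fun t => (v t)^-1) =1 u}.
  near=> t; rewrite /= mulfK//; near: t; exact: cvgr_neq0 vc c0.
exact: cvgP (cvg_trans (near_eq_cvg uE) (cvgM uvF (cvgV c0 vc))).
Unshelve. all: by end_near. Qed.

(* The roots z of z^r = a^r + k satisfy prod_z |z - a| = |k|. *)
Lemma exprn_root_near (K : numClosedFieldType) (r : nat) (a k e : K) :
  (0 < r)%N -> 0 < e -> `|k| < e ^+ r ->
  exists2 h, `|h| < e & (a + h) ^+ r = a ^+ r + k.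
Proof.
move=> r0 e0 ke; pose p : {poly K} := 'X^r - (a ^+ r + k)%:P.
have [s] := closed_field_poly_normal p.
rewrite (monicP (monicXnsubC _ r0)) scale1r => ps.
have size_s : size s = r.
  by apply: succn_inj; rewrite -(size_prod_XsubC s id) -ps size_XnsubC.
have [/hasP[z zs az]|/hasPn far] := boolP (has (fun z => `|z - a| < e) s).
  exists (z - a) => //; rewrite addrC subrK; apply/eqP.
  have : root p z by rewrite ps root_prod_XsubC.
  by rewrite /root /p !hornerE subr_eq0.
have norm_k : `|k| = \prod_(z <- s) `|z - a|.
  have -> : `|k| = `|p.[a]|.
    by rewrite /p !hornerE opprD addNKr normrN.
  rewrite ps horner_prod normr_prod; apply: eq_bigr => z _.
  by rewrite !hornerE distrC.
(* With no root within [e] of [a], each of the [r] factors is at least [e], which contradicts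
   [ke]. *)
have : e ^+ r <= `|k|.
  have <- : \prod_(z <- s) e = e ^+ r.
    by rewrite -size_s big_const_seq count_predT -Monoid.iteropE.
  rewrite norm_k !big_seq; apply: ler_prod => z zs; rewrite ltW//=.
  by rewrite real_leNgt ?far// gtr0_real.
by move=> /le_lt_trans/(_ ke); rewrite ltxx.
Qed.

Lemma is_derive_exprn (K : numFieldType) (r : nat) (a : K) :
  is_derive a (1 : K) (fun y : K => y ^+ r) (r%:R * a ^+ r.-1).
Proof.
have := @is_deriveX K K id r a 1 1 (is_derive_id _ _).
by rewrite exprfctE /GRing.scale/= mulr1.
Qed.

Lemma cvg_slope_exprn (K : numFieldType) (r : nat) (a : K) :
  h^-1 * ((a + h) ^+ r - a ^+ r) @[h --> 0^'] --> r%:R * a ^+ r.-1.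
Proof.
have [+ <-] := is_derive_exprn K r a.
rewrite /derivable /derive => dX.
have -> : (fun h : K => h^-1 * ((a + h) ^+ r - a ^+ r)) =
    fun h => h^-1 *: (((fun y : K => y ^+ r) \o shift a) (h *: (1 : K)) - a ^+ r).
  by apply/funext => h; rewrite /= /GRing.scale/= mulr1 [a + h]addrC.
exact: dX.
Qed.

Lemma cvg_exprn (K : numFieldType) (r : nat) (a : K) :
  y ^+ r @[y --> a] --> a ^+ r.
Proof.
apply: (@differentiable_continuous _ _ _ a (fun y : K => y ^+ r)).
by apply/derivable1_diffP; have [] := is_derive_exprn K r a.
Qed.

Lemma cvg_exprn_increment (K : numFieldType) (r : nat) (a : K) :
  (a + h) ^+ r - a ^+ r @[h --> 0^'] --> (0 : K).
Proof.
have id0 : h @[h --> (0 : K)^'] --> (0 : K).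
  by move=> A /(@nbhs_dnbhs K 0).
have -> : (fun h => (a + h) ^+ r - a ^+ r) =
    id \* (fun h => h^-1 * ((a + h) ^+ r - a ^+ r)).
  apply/funext => h /=; have [->|h0] := eqVneq h 0; last by rewrite mulVKf.
  by rewrite addr0 subrr mul0r.
have := @cvgM _ _ _ (dnbhs_filter (0 : K)) _ _ _ _ id0 (cvg_slope_exprn K r a).
by rewrite mul0r.
Qed.

(** One inclusion is openness: every small [k] is an increment of a small [h], by [exprn_root_near].
    The other is continuity, together with the nonzero slope at [a], which keeps the increment away
    from 0 for small [h != 0]. *)
Lemma dnbhs0_exprn_increment (K : numClosedFieldType) (r : nat) (a : K) :
  (0 < r)%N -> a != 0 -> ((a + h) ^+ r - a ^+ r) @[h --> 0^'] = 0^'.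
Proof.
move=> r0 a0; rewrite eqEsubset; split => A.
  move=> /nbhs_ballP[e /= e0 eA]; apply/nbhs_ballP; exists (e ^+ r) => /=.
    exact: exprn_gt0.
  move=> k; rewrite /ball/= sub0r normrN => ke k0.
  have [h he hk] := exprn_root_near _ r a k e r0 e0 ke.
  have /= := eA h; rewrite hk addrAC subrr add0r; apply.
    by rewrite /ball/= sub0r normrN.
  by apply: contra_neq k0 => h0; apply: (addrI (a ^+ r)); rewrite -hk h0 !addr0.
have c0 : r%:R * a ^+ r.-1 != 0.
  by rewrite mulf_neq0 ?expf_neq0// pnatr_eq0 -lt0n.
have slope0 : \forall h \near 0^', h^-1 * ((a + h) ^+ r - a ^+ r) != 0.
  exact: cvgr_neq0 (cvg_slope_exprn K r a) c0.
have incr0 := cvg_exprn_increment K r a.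
move=> A0; have /= := incr0 _ A0.
apply: filterS2 slope0 => h /=.
by rewrite mulf_eq0 negb_or => /andP[_ ph0]; exact.
Qed.

Section PowerMap.
Context {R : realType} {n : nat}.
Implicit Types (x : 'rV[CC R]_n) (f g : pfun R n).

(** The difference quotient on the left is that of [g] at the increment [p h], times the slope of
    the power map, which tends to [c != 0]. *)
Lemma derive_comp_powv (r : nat) (g : 'rV[CC R]_n -> CC R) x i :
  (0 < r)%N -> x 0 i != 0 ->
  'D_(delta_mx 0 i) (g \o powv r) x =
    r%:R * x 0 i ^+ r.-1 * 'D_(delta_mx 0 i) g (powv r x).
Proof.
move=> r0 xi0; set c := _ * _ ^+ _; set e := delta_mx 0 i.
have c0 : c != 0 by rewrite mulf_neq0 ?expf_neq0// pnatr_eq0 -lt0n.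
pose p h := (x 0 i + h) ^+ r - x 0 i ^+ r.
pose q (k : CC R) : CC R := k^-1 * (g (k *: e + powv r x) - g (powv r x)).
have powvD h : powv r (h *: e + x) = p h *: e + powv r x.
  apply/rowP => j; rewrite !mxE eqxx/=; case: eqVneq => [->|_].
    by rewrite !mulr1 addrC addrNK addrC.
  by rewrite !mulr0 !add0r.
have slope := cvg_slope_exprn (CC R) r (x 0 i).
(* Since [p] sends the filter [0^'] to itself, precomposing with [p] does not change the limit, even
   a default one. *)
have dg : 'D_e g (powv r x) = lim (q \o p @ (0 : CC R)^').
  transitivity (lim (q @ (0 : CC R)^')); first by [].
  by rewrite -[in LHS](dnbhs0_exprn_increment (CC R) r (x 0 i) r0 xi0).
have := lim_mul_cvg_neq0 _ _ _ (Proper_dnbhs_numFieldType (0 : CC R)) (q \o p) _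
  c c0 slope.
rewrite dg mulrC => <-.
have quotE : (fun h => h^-1 * (g (powv r (h *: e + x)) - g (powv r x))) =
    (q \o p) \* (fun h => h^-1 * p h).
  apply/funext => h /=; rewrite powvD /q.
  (* [p h] may vanish for [h != 0], when [x 0 i] is multiplied by a root of unity; both sides are
     then 0. *)
  have [->|p0] := eqVneq (p h) 0.
    by rewrite scale0r add0r subrr !mulr0.
  by rewrite [RHS]mulrC mulrA mulfK.
by rewrite -quotE.
Qed.

Lemma Omega_open : open (@Omega R n).
Proof.
rewrite openE => x Ox; exists (fun _ _ => [set z : CC R | z != 0]).
  by move=> i j; rewrite ord1; exact: (@cvgr_neq0 (CC R) (CC R) _ _
    (nbhs_filter (x 0 j)) id _ (@cvg_id _ _) (Ox j)).
by move=> y y0 i; exact: y0.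
Qed.

Lemma powv_continuous (r : nat) : continuous (@powv R n r).
Proof.
move=> x A [P xP PA]; exists (fun i j => (fun z : CC R => z ^+ r) @^-1` P i j).
  move=> i j; apply: cvg_exprn; have := xP i j.
  by rewrite mxE ord1.
by move=> y yP; apply: PA => i j; have := yP i j; rewrite !ord1 mxE.
Qed.


(** The pair [f], [g] is arbitrary so that, for [Comp], the results of [L2] can be fed to [L1].
    Values are compared on all of [Omega], even outside the domains, so derivatives can be compared
    at each of its points. *)
Lemma transfer_powv (r : nat) (L : lexpr R n) f g :
  (0 < r)%N ->
  (forall x, Omega x -> pfun_val g x = pfun_val f (powv r x)) ->
  (forall x, Omega x -> pfun_dom f (powv r x) -> pfun_dom g x) ->
  (forall x, Omega x ->
    pfun_val (transfer r L g) x = pfun_val (lact L f) (powv r x)) /\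
  (forall x, Omega x ->
    pfun_dom (lact L f) (powv r x) -> pfun_dom (transfer r L g) x).
Proof.
move=> r0; elim: L f g => [i|q|i j ij|L1 IH1 L2 IH2|L1 IH1 L2 IH2] f g gf dfg.
- split=> x Ox /=; last by move=> /dfg-/(_ Ox); split.
  (* The two functions agree only on [Omega], but it is open, hence a neighbourhood of [x]. *)
  have -> : 'D_(delta_mx 0 i) (pfun_val g) x =
            'D_(delta_mx 0 i) (pfun_val f \o powv r) x.
    apply: near_eq_derive; apply: filterS (open_nbhs_nbhs (conj Omega_open Ox)).
    exact: gf.
  by rewrite derive_comp_powv// mulKf// mulf_neq0 ?expf_neq0// pnatr_eq0 -lt0n.
- by split=> x Ox /=; [rewrite gf|case=> /dfg-/(_ Ox)].
- have sOmega x : Omega x -> Omega (swapv i j x).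
    by move=> Ox k; rewrite !mxE.
  have sE x : powv r (swapv i j x) = swapv i j (powv r x).
    by apply/rowP => k; rewrite !mxE.
  by split=> x Ox /=; [rewrite gf ?sE//; exact: sOmega|
    rewrite -sE; apply: dfg; exact: sOmega].
- have [v1 d1] := IH1 _ _ gf dfg; have [v2 d2] := IH2 _ _ gf dfg.
  split=> x Ox /=; first by rewrite -v1// -v2.
  by case=> /d1-/(_ Ox) ? /d2-/(_ Ox).
- by have [v2 d2] := IH2 _ _ gf dfg; exact: IH1.
Qed.

End PowerMap.

Theorem proposition3p15 (R : realType) (n r : nat)
    (hn : (1 <= n)%N) (hr : (1 <= r)%N)
    (x0 : 'rV[CC R]_n) (hx0 : Omega x0)
    (L : lexpr R n)
    (U : set 'rV[CC R]_n) (eta : 'rV[CC R]_n -> CC R)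
    (heta : holomorphic_on U eta)
    (hU : forall s : 'S_n, s \in <<swaps L>>%g -> U (col_perm s (powv r x0)))
    (hdef : \forall y \near powv r x0, pfun_dom (lact L (PFun U eta)) y) :
  let phi := PFun (powv r @^-1` U) (eta \o powv r) in
  \forall x \near x0,
    pfun_dom (transfer r L phi) x /\
    pfun_val (transfer r L phi) x = pfun_val (lact L (PFun U eta)) (powv r x).
Proof.
move=> phi.
have [vE dE] := transfer_powv r L (PFun U eta) phi hr
  (fun _ _ => erefl) (fun _ _ => id).
have Ox : \forall x \near x0, Omega x.
  exact: open_nbhs_nbhs (conj Omega_open hx0).
(* Continuity of [powv r] pulls the neighbourhood in [hdef] back to one of [x0]. *)
apply: filterS2 Ox (powv_continuous r x0 _ hdef) => x Ox dx.
by split; [exact: dE|exact: vE].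
Qed.
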